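(* Let $\mathbb{F}$ be an algebraically closed field, $q\in\mathbb{F}$ with $q\neq 0$, and $f,g\in\mathbb{F}[h]$. Let $\alpha,\alpha'\in\mathbb{F}$ and $n\geq 1$ be such that $\nu_\alpha(n)=0=\nu_{\alpha'}(n)$ and $\nu_\alpha(i)\neq 0$, $\nu_{\alpha'}(i)\neq 0$ for all $1\leq i\leq n-1$. Then $\mathsf{C}_{q,f,g}(\alpha)/\mathbb{F}[t]t^n\simeq\mathsf{C}_{q,f,g}(\alpha')/\mathbb{F}[t]t^n$ as $\mathcal{H}_q(f,g)$-modules if and only if $\alpha=\alpha'$.
   Context: $\mathcal{H}_q(f,g)$ is the unital associative $\mathbb{F}$-algebra generated by $x,y,h$ with defining relations $hx=xf(h)$, $yh=f(h)y$, $yx-qxy=g(h)$; modules are left modules. $f^{[k]}$ is the $k$-fold compositional power of $f$ ($f^{[0]}(h)=h$). For $\alpha\in\mathbb{F}$, $\nu_\alpha:\mathbb{Z}_{\geq0}\to\mathbb{F}$ is $\nu_\alpha(i)=\sum_{j=0}^{i-1}q^jg(f^{[i-1-j]}(\alpha))$, and $\mathsf{C}_{q,f,g}(\alpha)$ is the module with underlying space $\mathbb{F}[t]$ and action $ht^i=f^{[i]}(\alpha)t^i$, $xt^i=t^{i+1}$, $yt^i=\nu_\alpha(i)t^{i-1}$ for $i\geq 0$, with $yt^0=0$. When $\nu_\alpha(n)=0$, $\mathbb{F}[t]t^n$ is a submodule. *)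

(* Defs.v *)
From HB Require Import structures.
From mathcomp Require Import all_boot all_algebra ring_quotient generic_quotient.
From mathcomp Require Import boolp.

Set Implicit Arguments.
Unset Strict Implicit.
Unset Printing Implicit Defensive.

Import GRing.Theory.
Local Open Scope ring_scope.
Local Open Scope quotient_scope.

(* The algebra H_q(f, g) is built as formal expressions in x, y, h with        *)
(* coefficients in F, modulo the least congruence that contains the axioms of  *)
(* unital associative F-algebras and the three defining relations.             *)
Section HAlgebra.
Variable F : fieldType.

Inductive hterm : Type :=
| TConst of F
| TX | TY | TH
| TAdd of hterm & hterm
| TMul of hterm & hterm.

(* p(t), in Horner form *)
Definition tpoly (p : {poly F}) (t : hterm) : hterm :=
  foldr (fun c u => TAdd (TMul u t) (TConst c)) (TConst 0) p.

HB.instance Definition _ := gen_eqMixin hterm.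
HB.instance Definition _ := gen_choiceMixin hterm.

Variables (q : F) (f g : {poly F}).

Inductive hcong : hterm -> hterm -> Prop :=
| hc_refl t : hcong t t
| hc_sym t u : hcong t u -> hcong u t
| hc_trans t u v : hcong t u -> hcong u v -> hcong t v
| hc_add t t' u u' : hcong t t' -> hcong u u' -> hcong (TAdd t u) (TAdd t' u')
| hc_mul t t' u u' : hcong t t' -> hcong u u' -> hcong (TMul t u) (TMul t' u')
| hc_addA t u v : hcong (TAdd t (TAdd u v)) (TAdd (TAdd t u) v)
| hc_addC t u : hcong (TAdd t u) (TAdd u t)
| hc_add0 t : hcong (TAdd (TConst 0) t) t
| hc_addN t : hcong (TAdd (TMul (TConst (- 1)) t) t) (TConst 0)
| hc_mulA t u v : hcong (TMul t (TMul u v)) (TMul (TMul t u) v)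
| hc_1mul t : hcong (TMul (TConst 1) t) t
| hc_mul1 t : hcong (TMul t (TConst 1)) t
| hc_mulDl t u v : hcong (TMul (TAdd t u) v) (TAdd (TMul t v) (TMul u v))
| hc_mulDr t u v : hcong (TMul t (TAdd u v)) (TAdd (TMul t u) (TMul t v))
| hc_constD a b : hcong (TConst (a + b)) (TAdd (TConst a) (TConst b))
| hc_constM a b : hcong (TConst (a * b)) (TMul (TConst a) (TConst b))
| hc_constC a t : hcong (TMul (TConst a) t) (TMul t (TConst a))
| hc_hx : hcong (TMul TH TX) (TMul TX (tpoly f TH))
| hc_yh : hcong (TMul TY TH) (TMul (tpoly f TH) TY)
| hc_yx : hcong (TAdd (TMul TY TX)
                      (TMul (TConst (- 1)) (TMul (TConst q) (TMul TX TY))))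
                (tpoly g TH).

Definition hcongb (t u : hterm) : bool := `[< hcong t u >].

Lemma hcongb_equiv : equiv_class_of hcongb.
Proof.
split=> [t|t u|u t v].
- by apply/asboolP; apply: hc_refl.
- by apply/asboolP/asboolP; apply: hc_sym.
- by move=> /asboolP tu /asboolP uv; apply/asboolP; apply: hc_trans tu uv.
Qed.

Canonical hcongb_equivRel := EquivRelPack hcongb_equiv.
Canonical hcongb_encModRel := defaultEncModRel hcongb.

Definition Halg : Type := {eq_quot hcongb}.
HB.instance Definition _ := Choice.on Halg.

Definition hpi (t : hterm) : Halg := \pi_({eq_quot hcongb}) t.
Definition hrepr (a : Halg) : hterm := repr (a : {eq_quot hcongb}).

Lemma hpiP t u : hpi t = hpi u <-> hcong t u.
Proof.
split=> [/eqmodP /asboolP //|tu]; first by apply/eqmodP/asboolP.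
Qed.

Lemma hreprK a : hpi (hrepr a) = a. Proof. exact: reprK. Qed.

Lemma hrepr_pi t : hcong (hrepr (hpi t)) t.
Proof. by apply/hpiP; rewrite hreprK. Qed.

Definition hadd (a b : Halg) : Halg := hpi (TAdd (hrepr a) (hrepr b)).
Definition hmul (a b : Halg) : Halg := hpi (TMul (hrepr a) (hrepr b)).
Definition hopp (a : Halg) : Halg := hpi (TMul (TConst (- 1)) (hrepr a)).

Lemma hpiD t u : hpi (TAdd t u) = hadd (hpi t) (hpi u).
Proof. by apply/hpiP/hc_add; apply/hc_sym/hrepr_pi. Qed.

Lemma hpiM t u : hpi (TMul t u) = hmul (hpi t) (hpi u).
Proof. by apply/hpiP/hc_mul; apply/hc_sym/hrepr_pi. Qed.

Lemma hpiN t : hpi (TMul (TConst (- 1)) t) = hopp (hpi t).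
Proof. by apply/hpiP/hc_mul; [exact: hc_refl | apply/hc_sym/hrepr_pi]. Qed.

Lemma haddA : associative hadd.
Proof.
move=> a b c; rewrite -[a]hreprK -[b]hreprK -[c]hreprK -!hpiD.
exact/hpiP/hc_addA.
Qed.

Lemma haddC : commutative hadd.
Proof.
by move=> a b; rewrite -[a]hreprK -[b]hreprK -!hpiD; apply/hpiP/hc_addC.
Qed.

Lemma hadd0 : left_id (hpi (TConst 0)) hadd.
Proof. by move=> a; rewrite -[a]hreprK -hpiD; apply/hpiP/hc_add0. Qed.

Lemma haddN : left_inverse (hpi (TConst 0)) hopp hadd.
Proof. by move=> a; rewrite -[a]hreprK -hpiN -hpiD; apply/hpiP/hc_addN. Qed.

Lemma hmulA : associative hmul.
Proof.
move=> a b c; rewrite -[a]hreprK -[b]hreprK -[c]hreprK -!hpiM.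
exact/hpiP/hc_mulA.
Qed.

Lemma h1mul : left_id (hpi (TConst 1)) hmul.
Proof. by move=> a; rewrite -[a]hreprK -hpiM; apply/hpiP/hc_1mul. Qed.

Lemma hmul1 : right_id (hpi (TConst 1)) hmul.
Proof. by move=> a; rewrite -[a]hreprK -hpiM; apply/hpiP/hc_mul1. Qed.

Lemma hmulDl : left_distributive hmul hadd.
Proof.
move=> a b c; rewrite -[a]hreprK -[b]hreprK -[c]hreprK.
by rewrite -hpiD -!hpiM -hpiD; apply/hpiP/hc_mulDl.
Qed.

Lemma hmulDr : right_distributive hmul hadd.
Proof.
move=> a b c; rewrite -[a]hreprK -[b]hreprK -[c]hreprK.
by rewrite -hpiD -!hpiM -hpiD; apply/hpiP/hc_mulDr.
Qed.

HB.instance Definition _ := GRing.isPzRing.Build Halg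
  haddA haddC hadd0 haddN hmulA h1mul hmul1 hmulDl hmulDr.

Definition hscale (c : F) (a : Halg) : Halg := hpi (TConst c) * a.

Lemma hscaleA c d a : hscale c (hscale d a) = hscale (c * d) a.
Proof.
rewrite /hscale mulrA; congr (_ * _).
by rewrite -[LHS]hpiM; apply/hpiP/hc_sym/hc_constM.
Qed.

Lemma hscale1 : left_id 1 hscale. Proof. exact: mul1r. Qed.

Lemma hscaleDr : right_distributive hscale +%R.
Proof. by move=> c a b; rewrite /hscale mulrDr. Qed.

Lemma hscaleDl a : {morph hscale^~ a : c d / c + d}.
Proof.
move=> c d; rewrite /hscale -mulrDl; congr (_ * _).
by rewrite -[RHS]hpiD; apply/hpiP/hc_constD.
Qed.

HB.instance Definition _ := GRing.Zmodule_isLmodule.Build F Halg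
  hscaleA hscale1 hscaleDr hscaleDl.

Definition hX : Halg := hpi TX.
Definition hY : Halg := hpi TY.
Definition hH : Halg := hpi TH.

End HAlgebra.

Section Verma.
Variables (F : fieldType) (q : F) (f g : {poly F}).

Definition fiter (k : nat) : {poly F} := iter k (fun p => f \Po p) 'X.

Definition nu (alpha : F) (i : nat) : F :=
  \sum_(j < i) q ^+ j * g.[(fiter (i - 1 - j)).[alpha]].

Lemma nu0 alpha : nu alpha 0 = 0. Proof. by rewrite /nu big_ord0. Qed.

Lemma nuS alpha i : nu alpha i.+1 = g.[(fiter i).[alpha]] + q * nu alpha i.
Proof.
rewrite /nu big_ord_recl expr0 mul1r subn0 subn1; congr (_ + _).
rewrite mulr_sumr; apply: eq_bigr => j _.
rewrite lift0 exprS mulrA; congr (_ * g.[(fiter _).[_]]).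
by rewrite -!subnDA.
Qed.

Variable alpha : F.

(* The F-linear maps of F[t] that satisfy h.t^i = f^[i](alpha) t^i,            *)
(* x.t^i = t^(i+1), y.t^i = nu(i) t^(i-1) and y.t^0 = 0.                       *)
Definition opH (p : {poly F}) : {poly F} :=
  \poly_(i < size p) (p`_i * (fiter i).[alpha]).
Definition opX (p : {poly F}) : {poly F} := p * 'X.
Definition opY (p : {poly F}) : {poly F} :=
  \poly_(i < (size p).-1) (p`_i.+1 * nu alpha i.+1).

Fixpoint tact (t : hterm F) (p : {poly F}) : {poly F} :=
  match t with
  | TConst c => c *: p
  | TX => opX p
  | TY => opY p
  | TH => opH p
  | TAdd t u => tact t p + tact u p
  | TMul t u => tact t (tact u p)
  end.

Lemma coef_opH p i : (opH p)`_i = p`_i * (fiter i).[alpha].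
Proof.
by rewrite coef_poly; case: ltnP => // le_pi; rewrite nth_default ?mul0r.
Qed.

Lemma coef_opY p i : (opY p)`_i = p`_i.+1 * nu alpha i.+1.
Proof.
rewrite coef_poly; case: ltnP => // le_pi; rewrite nth_default ?mul0r //.
by case: (size p) le_pi.
Qed.

Lemma tact_is_linear t : linear (tact t).
Proof.
elim: t => [c||||t IHt u IHu|t IHt u IHu] a p r /=.
- by rewrite scalerDr !scalerA mulrC.
- by rewrite /opX mulrDl scalerAl.
- by apply/polyP=> i; rewrite !(coefD, coefZ, coef_opY) mulrDl mulrA.
- by apply/polyP=> i; rewrite !(coefD, coefZ, coef_opH) mulrDl mulrA.
- by rewrite IHt IHu scalerDr addrACA.
- by rewrite IHu IHt.
Qed.

HB.instance Definition _ t := GRing.isLinear.Build F {poly F} {poly F} _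
  (tact t) (tact_is_linear t).

Lemma coef_tpoly r p i :
  (tact (tpoly r (TH F)) p)`_i = p`_i * r.[(fiter i).[alpha]].
Proof.
rewrite /tpoly /horner; elim: (polyseq r) p => [|c s IHs] p /=.
  by rewrite scale0r coef0 mulr0.
by rewrite coefD IHs coef_opH coefZ; rewrite mulrDr -!mulrA
  [c * _]mulrC [(fiter i).[_] * _]mulrC.
Qed.

Lemma tact_cong t u : hcong q f g t u -> tact t =1 tact u.
Proof.
have fiterS i : (fiter i.+1).[alpha] = f.[(fiter i).[alpha]].
  by rewrite /fiter iterS horner_comp.
elim=> {t u} /=.
- by [].
- by move=> t u _ IH p; rewrite IH.
- by move=> t u v _ IH1 _ IH2 p; rewrite IH1.
- by move=> t t' u u' _ IH1 _ IH2 p; rewrite IH1 IH2.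
- by move=> t t' u u' _ IH1 _ IH2 p; rewrite IH1 IH2.
- by move=> t u v p; rewrite addrA.
- by move=> t u p; rewrite addrC.
- by move=> t p; rewrite scale0r add0r.
- by move=> t p; rewrite scaleN1r addNr scale0r.
- by [].
- by move=> t p; rewrite scale1r.
- by move=> t p; rewrite scale1r.
- by [].
- by move=> t u v p; rewrite linearD.
- by move=> a b p; rewrite scalerDl.
- by move=> a b p; rewrite scalerA.
- by move=> a t p; rewrite linearZ.
- move=> p; apply/polyP=> -[|i]; rewrite coef_opH !coefMX /= ?mul0r //.
  by rewrite coef_tpoly fiterS.
- move=> p; apply/polyP=> i; rewrite coef_opY coef_opH coef_tpoly coef_opY.
  by rewrite fiterS mulrAC.
- move=> p; apply/polyP=> i; rewrite coefD coef_opY !coefZ coef_tpoly /opX.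
  rewrite !coefMX /= nuS mulrDr -addrA [X in _ + X](_ : _ = 0) ?addr0 //.
  case: i => [|i]; first by rewrite /= nu0 !mulr0 addr0.
  by rewrite coef_opY /= mulN1r mulrCA subrr.
Qed.

End Verma.

Section HAlgebraTheory.
Variables (F : fieldType) (q : F) (f g : {poly F}).
Local Notation H := (Halg q f g).

Lemma Halg_oner_neq0 : (1 : H) != 0.
Proof.
apply/eqP=> /hpiP /(@tact_cong _ _ _ _ 0) /(_ 1) /=.
by rewrite scale1r scale0r => /eqP; rewrite oner_eq0.
Qed.

HB.instance Definition _ :=
  GRing.PzSemiRing_isNonZero.Build H Halg_oner_neq0.

Lemma Halg_scalerAl (c : F) (a b : H) : c *: (a * b) = (c *: a) * b.
Proof. by rewrite [LHS]mulrA. Qed.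

HB.instance Definition _ :=
  GRing.Lmodule_isLalgebra.Build F H Halg_scalerAl.

Lemma hpi_constC c (a : H) : hpi q f g (TConst c) * a = a * hpi q f g (TConst c).
Proof.
rewrite -[a]hreprK; have E := @hpiM F q f g.
by rewrite -[LHS]E -[RHS]E; apply/hpiP/hc_constC.
Qed.

Lemma Halg_scalerAr (c : F) (a b : H) : c *: (a * b) = a * (c *: b).
Proof. by rewrite [LHS]mulrA hpi_constC -mulrA. Qed.

HB.instance Definition _ :=
  GRing.Lalgebra_isAlgebra.Build F H Halg_scalerAr.

Lemma Halg_algE (c : F) : c%:A = hpi q f g (TConst c).
Proof. by rewrite -[LHS]/(hpi _ _ _ _ * 1) mulr1. Qed.

Lemma hpi_tpoly (p : {poly F}) t :
  hpi q f g (tpoly p t) = horner_alg (hpi q f g t) p.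
Proof.
rewrite -[p in RHS]polyseqK /tpoly; elim: (polyseq p) => [|c s IHs] /=.
  by rewrite rmorph0.
rewrite cons_poly_def rmorphD rmorphM /= horner_algX horner_algC.
by rewrite hpiD hpiM IHs Halg_algE.
Qed.

Lemma Halg_hx : hH q f g * hX q f g = hX q f g * horner_alg (hH q f g) f.
Proof. by rewrite -hpi_tpoly -[LHS]hpiM -[RHS]hpiM; apply/hpiP/hc_hx. Qed.

Lemma Halg_yh : hY q f g * hH q f g = horner_alg (hH q f g) f * hY q f g.
Proof. by rewrite -hpi_tpoly -[LHS]hpiM -[RHS]hpiM; apply/hpiP/hc_yh. Qed.

Lemma Halg_yx :
  hY q f g * hX q f g - q *: (hX q f g * hY q f g) = horner_alg (hH q f g) g.
Proof.
rewrite -hpi_tpoly -(iffRL (hpiP _ _ _ _ _) (hc_yx q f g)).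
by rewrite hpiD hpiN !hpiM.
Qed.

Section Universal.
Variables (A : algType F) (x y h : A).
Hypothesis hx : h * x = x * horner_alg h f.
Hypothesis yh : y * h = horner_alg h f * y.
Hypothesis yx : y * x - q *: (x * y) = horner_alg h g.

Fixpoint teval (t : hterm F) : A :=
  match t with
  | TConst c => c%:A
  | TX => x
  | TY => y
  | TH => h
  | TAdd t u => teval t + teval u
  | TMul t u => teval t * teval u
  end.

Lemma teval_tpoly p t : teval (tpoly p t) = horner_alg (teval t) p.
Proof.
rewrite -[p in RHS]polyseqK /tpoly; elim: (polyseq p) => [|c s IHs] /=.
  by rewrite rmorph0 scale0r.
by rewrite cons_poly_def rmorphD rmorphM /= horner_algX horner_algC IHs.
Qed.

Lemma teval_cong t u : hcong q f g t u -> teval t = teval u.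
Proof.
elim=> {t u} /=; rewrite ?teval_tpoly //=.
- by move=> t u v _ -> _ ->.
- by move=> t t' u u' _ -> _ ->.
- by move=> t t' u u' _ -> _ ->.
- by move=> *; rewrite addrA.
- by move=> *; rewrite addrC.
- by move=> *; rewrite scale0r add0r.
- by move=> *; rewrite scaleN1r mulN1r addNr scale0r.
- by move=> *; rewrite mulrA.
- by move=> *; rewrite scale1r mul1r.
- by move=> *; rewrite scale1r mulr1.
- by move=> *; rewrite mulrDl.
- by move=> *; rewrite mulrDr.
- by move=> *; rewrite scalerDl.
- by move=> *; rewrite -scalerAl mul1r scalerA.
- by move=> a t; rewrite -scalerAl mul1r -scalerAr mulr1.
- by rewrite scaleN1r mulN1r -scalerAl mul1r.
Qed.

Definition hlift (a : H) : A := teval (hrepr a).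

Lemma hlift_pi t : hlift (hpi q f g t) = teval t.
Proof. exact/teval_cong/hrepr_pi. Qed.

Lemma hlift_linear : linear hlift.
Proof.
move=> c a b; rewrite -[a]hreprK -[b]hreprK.
rewrite -[c *: _](@hpiM _ _ _ _ (TConst c)) -[_ + _]hpiD !hlift_pi /=.
by rewrite -scalerAl mul1r.
Qed.

Lemma hlift_monoid_morphism : monoid_morphism hlift.
Proof.
split=> [|a b]; first by rewrite [LHS]hlift_pi /= scale1r.
by rewrite -[a]hreprK -[b]hreprK -[_ * _]hpiM !hlift_pi.
Qed.

HB.instance Definition _ := GRing.isLinear.Build F H A _ hlift hlift_linear.
HB.instance Definition _ :=
  GRing.isMonoidMorphism.Build H A hlift hlift_monoid_morphism.

Lemma Halg_universal :
  exists2 phi : {lrmorphism H -> A},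
    [/\ phi (hX q f g) = x, phi (hY q f g) = y & phi (hH q f g) = h] &
    forall psi : {lrmorphism H -> A},
      [/\ psi (hX q f g) = x, psi (hY q f g) = y & psi (hH q f g) = h] ->
      psi =1 phi.
Proof.
exists hlift => [|psi [psiX psiY psiH] a]; first by split; apply: hlift_pi.
rewrite -[a]hreprK [RHS]hlift_pi; elim: (hrepr a) => [c||||t IHt u IHu|t IHt u IHu] //=.
- by rewrite -Halg_algE linearZ /= rmorph1.
- by rewrite hpiD -IHt -IHu; apply: raddfD.
- by rewrite hpiM -IHt -IHu; apply: rmorphM.
Qed.

End Universal.

End HAlgebraTheory.

(* The parameters are phantom: they select the action of H_q(f, g) below. *)
Definition Cqfg (F : fieldType) (q : F) (f g : {poly F}) (alpha : F) : Type :=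
  {poly F}.

Section VermaModule.
Variables (F : fieldType) (q : F) (f g : {poly F}) (alpha : F).
Local Notation H := (Halg q f g).
Local Notation Cmod := (Cqfg q f g alpha).

HB.instance Definition _ := GRing.Zmodule.on Cmod.

Definition cact (a : H) (v : Cmod) : Cmod := tact q f g alpha (hrepr a) v.

Lemma cact_pi t v : cact (hpi q f g t) v = tact q f g alpha t v.
Proof. exact/tact_cong/hrepr_pi. Qed.

Lemma cactA a b v : cact a (cact b v) = cact (a * b) v.
Proof. by rewrite -[a]hreprK -[b]hreprK -[_ * _]hpiM !cact_pi. Qed.

Lemma cact1 : left_id 1 cact.
Proof. by move=> v; rewrite [LHS]cact_pi /= scale1r. Qed.

Lemma cactDr : right_distributive cact +%R.
Proof. by move=> a u v; rewrite /cact [LHS]linearD. Qed.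

Lemma cactDl v : {morph cact^~ v : a b / a + b}.
Proof.
by move=> a b; rewrite -[a]hreprK -[b]hreprK -[_ + _]hpiD !cact_pi.
Qed.

HB.instance Definition _ := GRing.Zmodule_isLmodule.Build H Cmod
  cactA cact1 cactDr cactDl.

Definition tpow (i : nat) : Cmod := 'X^i : {poly F}.

Lemma Cmod_scalar (c : F) (v : Cmod) :
  c%:A%R *: v = (c *: (v : {poly F}) : {poly F}).
Proof. by rewrite Halg_algE [LHS]cact_pi. Qed.

Lemma Cmod_h i :
  hH q f g *: tpow i = ((fiter f i).[alpha])%:A%R *: tpow i.
Proof.
rewrite Cmod_scalar [LHS]cact_pi; apply/polyP=> j /=.
rewrite coef_opH coefZ !coefXn; case: eqP => [->|_]; last by rewrite mul0r mulr0.
by rewrite mulrC.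
Qed.

Lemma Cmod_x i : hX q f g *: tpow i = tpow i.+1.
Proof. by rewrite [LHS]cact_pi /= /opX [RHS]exprSr. Qed.

Lemma Cmod_y0 : hY q f g *: tpow 0 = 0.
Proof.
by rewrite [LHS]cact_pi; apply/polyP=> j /=; rewrite coef_opY coefXn mul0r coef0.
Qed.

Lemma Cmod_yS i :
  hY q f g *: tpow i.+1 = (nu q f g alpha i.+1)%:A%R *: tpow i.
Proof.
rewrite Cmod_scalar [LHS]cact_pi; apply/polyP=> j /=.
rewrite coef_opY coefZ !coefXn eqSS; case: eqP => [->|_].
  by rewrite mulrC.
by rewrite mul0r mulr0.
Qed.

(* F[t]t^n *)
Definition tpow_span (n : nat) : {pred Cmod} :=
  fun v => ('X^n : {poly F}) %| (v : {poly F}).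

Lemma tpow_spanP n (p : {poly F}) :
  reflect (forall i, (i < n)%N -> p`_i = 0) ('X^n %| p).
Proof.
apply: (iffP idP) => [/dvdpP[r ->] i lt_in|p0]; first by rewrite coefMXn lt_in.
rewrite -(poly_take_drop n p) (_ : take_poly n p = 0) ?add0r ?dvdp_mull //.
by apply/polyP=> i; rewrite coef_take_poly coef0; case: ifP => // /p0.
Qed.

Lemma tact_tpow_span n t p : nu q f g alpha n = 0 ->
  'X^n %| p -> 'X^n %| tact q f g alpha t p.
Proof.
move=> nu_n; elim: t p => [c||||t IHt u IHu|t IHt u IHu] p pn /=.
- by rewrite -mul_polyC dvdp_mull.
- by rewrite /opX dvdp_mulr.
- apply/tpow_spanP=> i; rewrite leq_eqVlt coef_opY => /orP[/eqP->|lt_in].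
    by rewrite nu_n mulr0.
  by move/tpow_spanP: pn => ->; rewrite ?mul0r.
- apply/tpow_spanP=> i lt_in; rewrite coef_opH.
  by move/tpow_spanP: pn => ->; rewrite ?mul0r.
- by rewrite dvdp_add ?IHt ?IHu.
- by apply/IHt/IHu.
Qed.

Lemma tpow_span_submod n : nu q f g alpha n = 0 ->
  GRing.subsemimod_closed (tpow_span n).
Proof.
move=> nu_n; split=> [|a v /(tact_tpow_span (hrepr a) nu_n) //].
by split=> [|u v un vn]; [apply: dvdp0 | apply: dvdp_add].
Qed.

Definition Csub n (nu_n : nu q f g alpha n = 0) : submodClosed Cmod :=
  HB.pack (tpow_span n)
    (GRing.isSubSemiModClosed.Build H Cmod (tpow_span n)
       (tpow_span_submod nu_n)).

End VermaModule.

(* ring_quotient equips V / U with its additive group structure only. *)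
Section LmodQuotient.
Variables (R : pzRingType) (V : lmodType R) (U : submodClosed V).

Lemma submod_zmod_closed : zmod_closed (U : {pred V}).
Proof.
split=> [|u v uU vU]; first exact: rpred0.
by rewrite rpredD // -scaleN1r rpredZ.
Qed.

Definition submod_zmod : zmodClosed V :=
  HB.pack (U : {pred V})
    (GRing.isZmodClosed.Build V (U : {pred V}) submod_zmod_closed).

Definition lquot : Type := Quotient.quot submod_zmod.
HB.instance Definition _ := GRing.Zmodule.on lquot.

Definition lpi (v : V) : lquot := \pi_(Quotient.quot submod_zmod) v.
Definition lrepr (w : lquot) : V := repr (w : Quotient.quot submod_zmod).

Lemma lreprK w : lpi (lrepr w) = w. Proof. exact: reprK. Qed.

Lemma lpiP u v : reflect (lpi u = lpi v) (u - v \in U).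
Proof.
have E := Quotient.idealrBE submod_zmod u v.
by apply: (iffP idP) => [uv|/eqP uv]; [apply/eqP; rewrite -E | rewrite -E in uv].
Qed.

Lemma lpiD u v : lpi (u + v) = lpi u + lpi v.
Proof. exact: raddfD. Qed.

Definition lqscale (a : R) (w : lquot) : lquot := lpi (a *: lrepr w).

Lemma lpiZ a v : lpi (a *: v) = lqscale a (lpi v).
Proof. by apply/lpiP; rewrite -scalerBr rpredZ //; apply/lpiP; rewrite lreprK. Qed.

Lemma lqscaleA a b w : lqscale a (lqscale b w) = lqscale (a * b) w.
Proof. by rewrite -[w]lreprK -!lpiZ scalerA. Qed.

Lemma lqscale1 : left_id 1 lqscale.
Proof. by move=> w; rewrite -[w]lreprK -lpiZ scale1r. Qed.

Lemma lqscaleDr : right_distributive lqscale +%R.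
Proof.
by move=> a u v; rewrite -[u]lreprK -[v]lreprK -lpiD -!lpiZ -lpiD scalerDr.
Qed.

Lemma lqscaleDl w : {morph lqscale^~ w : a b / a + b}.
Proof. by move=> a b; rewrite -[w]lreprK -!lpiZ -lpiD scalerDl. Qed.

HB.instance Definition _ := GRing.Zmodule_isLmodule.Build R lquot
  lqscaleA lqscale1 lqscaleDr lqscaleDl.

End LmodQuotient.

Definition lmod_iso (R : pzRingType) (V W : lmodType R) : Prop :=
  exists phi : {linear V -> W}, bijective phi.

(* Main.v *)
Require Import Defs.
From HB Require Import structures.
From mathcomp Require Import all_boot all_algebra.

Import GRing.Theory.
Local Open Scope ring_scope.

(** In C(alpha) / F[t]t^n the element y lowers the degree of t^i by one with
    coefficient nu(i), which is nonzero for 0 < i < n.  So the class of t^0 spans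
    the kernel of y, and h acts on that kernel by the scalar alpha.  The kernel of
    y and the action of h on it are carried along by every H-linear map, so that
    alpha can be recovered from the isomorphism class of the quotient
    ([Cquot_ker_y]).  Conversely, equal parameters give literally the same
    quotient, since F has at most one proof of each equality. *)

Lemma lpiZ_quot (R : pzRingType) (V : lmodType R) (U : submodClosed V) a v :
  lpi U (a *: v) = a *: lpi U v.
Proof. exact: lpiZ. Qed.

Section VermaQuotient.
Variables (F : fieldType) (q : F) (f g : {poly F}) (alpha : F) (n : nat).
Hypothesis nu_n : nu q f g alpha n = 0.
Local Notation H := (Halg q f g).
Local Notation Q := (lquot (Csub nu_n)).

Lemma Cquot_eq0P (v : Cqfg q f g alpha) :
  reflect (forall i, (i < n)%N -> (v : {poly F})`_i = 0) (lpi (Csub nu_n) v == 0).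
Proof.
have -> : (lpi (Csub nu_n) v == 0) = (v - 0 \in Csub nu_n).
  have E0 : lpi (Csub nu_n) 0 = 0 :> Q.
    by rewrite -[X in lpi _ X](scale0r (0 : Cqfg q f g alpha)) lpiZ_quot scale0r.
  by rewrite -E0; apply/eqP/lpiP.
rewrite subr0; exact: tpow_spanP.
Qed.

Lemma Cquot_t0_neq0 : (0 < n)%N -> lpi (Csub nu_n) (tpow q f g alpha 0) != 0.
Proof.
move=> n_gt0; apply/negP=> /Cquot_eq0P /(_ 0 n_gt0) /eqP.
by rewrite coefXn eqxx oner_eq0.
Qed.

Lemma Cquot_y_t0 : hY q f g *: lpi (Csub nu_n) (tpow q f g alpha 0) = 0.
Proof.
rewrite -lpiZ_quot Cmod_y0; apply/eqP/Cquot_eq0P=> i _; exact: coef0.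
Qed.

Lemma Cquot_h_t0 :
  hH q f g *: lpi (Csub nu_n) (tpow q f g alpha 0) =
  (alpha%:A : H) *: lpi (Csub nu_n) (tpow q f g alpha 0).
Proof. by rewrite -!lpiZ_quot Cmod_h hornerX. Qed.

(** A vector killed by y has no component on t^i for 0 < i < n, because nu(i)
    is nonzero there; it is thus a multiple of t^0, on which h has the only
    eigenvalue alpha. *)
Lemma Cquot_ker_y (beta : F) (w : Q) :
  (0 < n)%N -> (forall i, (0 < i < n)%N -> nu q f g alpha i != 0) ->
  hY q f g *: w = 0 -> hH q f g *: w = (beta%:A : H) *: w -> w != 0 ->
  beta = alpha.
Proof.
move=> n_gt0 nu_neq0; rewrite -[w]lreprK; move: (lrepr w) => {w} v.
rewrite -!lpiZ_quot => /eqP/Cquot_eq0P yv /lpiP hv; apply: contraNeq => ba.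
apply/Cquot_eq0P=> -[_|i lt_in].
  move/tpow_spanP: hv => /(_ 0 n_gt0).
  rewrite Cmod_scalar [hH q f g *: v]cact_pi coefB coef_opH coefZ hornerX.
  rewrite [beta * _]mulrC -mulrBr => /eqP.
  by rewrite mulf_eq0 subr_eq0 [alpha == _]eq_sym (negPf ba) orbF => /eqP.
have := yv i (ltnW lt_in); rewrite [hY q f g *: v]cact_pi coef_opY => /eqP.
by rewrite mulf_eq0 (negPf (nu_neq0 _ _)) ?orbF // => /eqP.
Qed.

End VermaQuotient.

(** The image of the class of t^0 is a nonzero vector of the target that y kills
    and that h scales by alpha, which forces alpha = alpha'. *)
Lemma Cquot_inj_linear (F : fieldType) (q : F) (f g : {poly F})
    (alpha alpha' : F) (n : nat)
    (nu_n : nu q f g alpha n = 0) (nu_n' : nu q f g alpha' n = 0)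
    (phi : {linear lquot (Csub nu_n) -> lquot (Csub nu_n')}) :
  (0 < n)%N -> (forall i, (0 < i < n)%N -> nu q f g alpha' i != 0) ->
  injective phi -> alpha = alpha'.
Proof.
move=> n_gt0 nu_neq0 phi_inj.
apply: (@Cquot_ker_y _ _ _ _ _ _ nu_n' alpha
          (phi (lpi (Csub nu_n) (tpow q f g alpha 0)))) => //.
- by rewrite -linearZ /= Cquot_y_t0 linear0.
- by rewrite -!linearZ /= Cquot_h_t0.
- by rewrite raddf_eq0 // Cquot_t0_neq0.
Qed.

Theorem proposition3p24 (F : closedFieldType) (q : F) (q_neq0 : q != 0)
    (f g : {poly F}) (alpha alpha' : F) (n : nat) (n_ge1 : (1 <= n)%N)
    (nu_n : nu q f g alpha n = 0) (nu_n' : nu q f g alpha' n = 0)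
    (nu_neq0 : forall i : nat, (1 <= i <= n - 1)%N -> nu q f g alpha i != 0)
    (nu_neq0' : forall i : nat, (1 <= i <= n - 1)%N -> nu q f g alpha' i != 0) :
  lmod_iso (lquot (Csub nu_n)) (lquot (Csub nu_n')) <-> alpha = alpha'.
Proof.
split=> [[phi /bij_inj phi_inj]|eq_alpha].
  apply: (@Cquot_inj_linear _ _ _ _ _ _ _ _ _ phi) => // i lt0in.
  by apply: nu_neq0'; rewrite leq_subRL // add1n.
case: _ / eq_alpha in nu_n' nu_neq0' *.
(* The two quotients now differ only in the proof of nu(n) = 0 they carry. *)
rewrite (eq_irrelevance nu_n' nu_n).
by exists idfun; exists idfun.
Qed.
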